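(* Let $G$ be an alternating group $\mathrm{Alt}_n$ or a symmetric group $\mathrm{Sym}_n$ of some finite degree $n$. Then the prime graph $\mathrm{GK}(G)$ and the solvable graph $\mathcal{S}(G)$ are both split graphs.
   Context: All graphs are simple and finite. A graph is split if its vertex set can be partitioned into a set inducing a complete graph (a clique) and an independent set; either set may be empty. For a finite group $G$, $\pi(G)$ denotes the set of prime divisors of $|G|$. The prime graph (Gruenberg–Kegel graph) $\mathrm{GK}(G)$ has vertex set $\pi(G)$, and two distinct primes $r,s\in\pi(G)$ are adjacent if and only if $G$ has an element of order $rs$. The solvable graph $\mathcal{S}(G)$ has vertex set $\pi(G)$, and two distinct primes $r,s\in\pi(G)$ are adjacent if and only if $G$ has a solvable subgroup of order divisible by $rs$. *)

(* Defs.v *)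
From HB Require Import structures.
From mathcomp Require Import all_boot all_fingroup all_solvable.

Set Implicit Arguments.
Unset Strict Implicit.
Unset Printing Implicit Defensive.

Local Open Scope group_scope.

Record sgraph := SGraph {
  vertex :> finType;
  edge : rel vertex;
  edge_sym : symmetric edge;
  edge_irr : irreflexive edge }.

Definition is_clique (X : sgraph) (A : {set X}) : Prop :=
  {in A &, forall x y, x != y -> edge x y}.

Definition is_independent (X : sgraph) (A : {set X}) : Prop :=
  {in A &, forall x y, ~~ edge x y}.

(* [partition] of finset is not used: it excludes empty blocks, whereas the
   clique or the independent set may be empty here. *)
Definition is_split (X : sgraph) : Prop :=
  exists A B : {set X},
    [/\ A :|: B = [set: X], [disjoint A & B], is_clique A & is_independent B].

Section GroupGraphs.

Variables (gT : finGroupType) (G : {group gT}).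

(* The set \pi(G) as a finite type. *)
Definition pi_vertex : finType := seq_sub (primes #|G|).

Definition GK_edge : rel pi_vertex := fun r s =>
  (r != s) && [exists x in G, #[x] == (val r * val s)%N].

Definition solv_edge : rel pi_vertex := fun r s =>
  (r != s) && [exists H : {group gT},
    [&& H \subset G, solvable H & (val r * val s)%N %| #|H|]].

Lemma GK_edge_sym : symmetric GK_edge.
Proof. by move=> r s; rewrite /GK_edge eq_sym mulnC. Qed.

Lemma GK_edge_irr : irreflexive GK_edge.
Proof. by move=> r; rewrite /GK_edge eqxx. Qed.

Lemma solv_edge_sym : symmetric solv_edge.
Proof. by move=> r s; rewrite /solv_edge eq_sym mulnC. Qed.

Lemma solv_edge_irr : irreflexive solv_edge.
Proof. by move=> r; rewrite /solv_edge eqxx. Qed.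

Definition GK_graph : sgraph := SGraph GK_edge_sym GK_edge_irr.

Definition solv_graph : sgraph := SGraph solv_edge_sym solv_edge_irr.

End GroupGraphs.

(* Main.v *)
(* Every group between Alt_n and Sym_n containing an element of order pq, with
   p <> q primes, satisfies p + q <= n.  Conversely, if p < q and 2q <= n, then
   an even element of order p and one of order q with disjoint supports exist,
   by Cauchy's theorem in the symmetric groups on these supports (for p = 2,
   on 4 points), except when n = 6 and p = 2.  So GK(G) has the clique
   {p : 2p <= n}, deprived of 2 when n = 6, and its complement is independent.
   For S(G) the pair {2, 3} is restored at n = 6 by a dihedral group of order
   6, so {p : 2p <= n} is a clique; 2 is added to it when n = 3.  If p < q
   both exceed n/2 then p^2 and q^2 do not divide n!, so a solvable group of
   order divisible by pq has a Hall subgroup of order pq; it would be cyclic by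
   Sylow's theorem, contradicting p + q > n, unless p | q - 1, and then
   q <= n < 2p forces q = p + 1 = 3 = n. *)
Require Import Defs.
From mathcomp Require Import all_boot all_fingroup all_solvable.
From mathcomp Require Import zify.

Set Implicit Arguments.
Unset Strict Implicit.
Unset Printing Implicit Defensive.

Local Open Scope group_scope.

Lemma is_split_pred (X : sgraph) (P : pred X) :
    (forall x y : X, x != y -> P x -> P y -> edge x y) ->
    (forall x y : X, x != y -> ~~ P x -> ~~ P y -> ~~ edge x y) ->
  is_split X.
Proof.
move=> clq ind; exists [set x | P x], (~: [set x | P x]); split.
- exact: setUCr.
- by rewrite -setI_eq0 setICr.
- by move=> x y; rewrite !inE => Px Py nxy; apply: clq.
move=> x y; rewrite !inE => Px Py; have [<-|nxy] := eqVneq x y.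
  by rewrite edge_irr.
exact: ind.
Qed.

(** * Cycle lengths of a permutation of order [p * q] *)

Lemma expg_dvd_porbit (T : finType) (x : {perm T}) a k :
  #|porbit x a| %| k -> (x ^+ k) a = a.
Proof.
have fix_a : (x ^+ #|porbit x a|) a = a by rewrite permX iter_porbit.
case/dvdnP=> j ->; elim: j => [|j IHj]; first by rewrite perm1.
by rewrite mulSn expgD permM fix_a.
Qed.

(** Cycle lengths divide the order [p * q]; if all were prime to [p] they would divide [q], so
    [x ^+ q] would be trivial. *)
Lemma exists_porbit_dvd (T : finType) (x : {perm T}) p q :
  prime p -> prime q -> #[x] = (p * q)%N -> exists a, p %| #|porbit x a|.
Proof.
move=> pr_p pr_q ox; apply/existsP; apply: contraT => /existsPn no_a.
have: x ^+ q = 1.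
  apply/permP => a; rewrite perm1; apply: expg_dvd_porbit.
  rewrite -(@Gauss_dvdr _ p) ?[coprime _ p]coprime_sym ?prime_coprime //.
  by rewrite -ox porbitE dvdn_orbit.
move/eqP; rewrite -order_dvdn ox => /dvdn_leq.
have := prime_gt1 pr_p; have := prime_gt0 pr_q; nia.
Qed.

(* Either a single cycle of [x] has length divisible by [p * q], or two
   different cycles have lengths divisible by [p] and by [q]. *)
Lemma order_primes_leq (T : finType) (x : {perm T}) p q :
  prime p -> prime q -> p != q -> #[x] = (p * q)%N -> p + q <= #|T|.
Proof.
move=> pr_p pr_q npq ox.
have [a pa] := exists_porbit_dvd pr_p pr_q ox.
have [b qb] : exists b, q %| #|porbit x b|.
  by apply: exists_porbit_dvd pr_q pr_p _; rewrite mulnC.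
have card_pos c : 0 < #|porbit x c| by rewrite lt0n card_porbit_neq0.
have [eq_ab | ne_ab] := eqVneq (porbit x a) (porbit x b).
  have: p * q %| #|porbit x a|.
    by rewrite Gauss_dvd ?pa ?eq_ab //= prime_coprime // dvdn_prime2.
  move/(dvdn_leq (card_pos a)) => /leq_trans/(_ (max_card _)).
  have := prime_gt1 pr_p; have := prime_gt1 pr_q; nia.
have /eqP dis_ab : porbit x a :&: porbit x b == set0.
  apply: contraR ne_ab => /set0Pn[c /setIP[]].
  by rewrite -!eq_porbit_mem => /eqP-> /eqP->.
apply: leq_trans (max_card (porbit x a :|: porbit x b)).
rewrite cardsU dis_ab cards0 subn0.
by apply: leq_add; apply: dvdn_leq (card_pos _) _.
Qed.

(** * Groups of order [p * q] and solvable subgroups of symmetric groups *)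

Lemma card_Syl_eq1 (gT : finGroupType) (K : {group gT}) p q :
  prime p -> prime q -> #|K| = (p * q)%N -> q %% p != 1%N -> #|'Syl_p(K)| = 1%N.
Proof.
move=> pr_p pr_q oK nq1; have mod1 := card_Syl_mod K pr_p.
have: #|'Syl_p(K)| %| q.
  rewrite -(@Gauss_dvdr _ p) -?oK ?card_Syl_dvd // coprime_sym prime_coprime //.
  by rewrite /dvdn mod1.
case/primeP: pr_q => _ divq /divq /orP[/eqP //|/eqP eq_q].
by rewrite -eq_q mod1 in nq1.
Qed.

(** Both Sylow subgroups are normal, the one for [q] because [p < q]. Their orders are coprime, so
    they meet trivially and commute elementwise. *)
Lemma exists_order_pq (gT : finGroupType) (K : {group gT}) p q :
    prime p -> prime q -> p < q -> q %% p != 1%N -> #|K| = (p * q)%N ->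
  exists2 x, x \in K & #[x] = (p * q)%N.
Proof.
move=> pr_p pr_q ltpq nq1 oK.
have /eqP/normal_sylowP[P sylP nP] := card_Syl_eq1 pr_p pr_q oK nq1.
have /eqP/normal_sylowP[Q sylQ nQ] : #|'Syl_q(K)| = 1%N.
  apply: (card_Syl_eq1 pr_q pr_p); first by rewrite mulnC.
  by rewrite modn_small //; have := prime_gt1 pr_p; lia.
have [x Px ox] : {x | x \in P & #[x] = p}.
  by apply: Cauchy => //; rewrite (card_Hall sylP) oK p_part dvdn_exp //
     logn_gt0 mem_primes pr_p muln_gt0 !prime_gt0 ?dvdn_mulr.
have [y Qy oy] : {y | y \in Q & #[y] = q}.
  by apply: Cauchy => //; rewrite (card_Hall sylQ) oK p_part dvdn_exp //
     logn_gt0 mem_primes pr_q muln_gt0 !prime_gt0 ?dvdn_mull.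
have co_pq : coprime p q by rewrite prime_coprime // dvdn_prime2 // neq_ltn ltpq.
have coPQ : coprime #|P| #|Q|.
  by rewrite (card_Hall sylP) (card_Hall sylQ) !p_part coprimeXl // coprimeXr.
have cxy : commute x y.
  apply/commgP; rewrite -in_set1 -[[set 1]](coprime_TIg coPQ).
  have := mem_commg Px Qy; apply: subsetP; apply: commg_subI.
    by rewrite subsetI subxx (subset_trans (normal_sub nP)) ?normal_norm.
  by rewrite subsetI subxx (subset_trans (normal_sub nQ)) ?normal_norm.
exists (x * y); last by rewrite orderM ?ox ?oy.
exact: groupM (subsetP (normal_sub nP) x Px) (subsetP (normal_sub nQ) y Qy).
Qed.

Lemma prime_dvd_fact p n : prime p -> p %| n`! -> p <= n.
Proof.
move=> pr_p; elim: n => [|n IHn]; first by rewrite dvdn1 => /eqP p1; rewrite p1 in pr_p.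
rewrite factS Euclid_dvdM // => /orP[/dvdn_leq|/IHn/leqW //]; exact.
Qed.

(** In Legendre's formula the first term is at most 1, and the others vanish because
    [n < 2 * p <= p ^ 2]. *)
Lemma logn_fact_leq1 p n : prime p -> n < p.*2 -> logn p n`! <= 1.
Proof.
move=> pr_p ltn2p; have gt1p := prime_gt1 pr_p.
have [->|n_gt0] := posnP n; first by rewrite logn1.
rewrite logn_fact // big_ltn // big1_seq => [|k].
  by rewrite addn0 expn1 -ltnS ltn_divLR ?prime_gt0 // mul2n.
rewrite andTb mem_index_iota => /andP[k_gt1 _].
apply: divn_small; apply: leq_trans (leq_pexp2l (prime_gt0 pr_p) k_gt1).
by rewrite (leq_trans ltn2p) // -mul2n leq_mul.
Qed.

Lemma solvable_pq_subgroup (gT : finGroupType) (H : {group gT}) p q :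
    prime p -> prime q -> p != q -> solvable H ->
    logn p #|H| = 1%N -> logn q #|H| = 1%N ->
  exists2 K : {group gT}, K \subset H & #|K| = (p * q)%N.
Proof.
move=> pr_p pr_q npq solH lp lq.
have [K hallK] := Hall_exists (pred2 p q) solH; exists K.
  exact: pHall_sub hallK.
have pq_gt0 : 0 < p * q by rewrite muln_gt0 !prime_gt0.
have pi_pq : (pred2 p q).-nat (p * q)%N.
  by rewrite pnatM !pnatE // !inE !eqxx orbT.
rewrite (card_Hall hallK) -[RHS](part_pnat_id pi_pq).
apply: eq_partn_from_log => // r /pred2P[]->;
  rewrite ?lp ?lq lognM ?prime_gt0 // !logn_prime // eqxx.
  by rewrite (negPf npq).
by rewrite eq_sym (negPf npq).
Qed.

Lemma solvable_pq_ndvd (T : finType) (H : {group {perm T}}) p q :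
    prime p -> prime q -> p < q -> #|T| < p.*2 -> #|T| != 3 ->
    solvable H -> ~~ (p * q %| #|H|).
Proof.
move=> pr_p pr_q ltpq ltT2p neqT3 solH; apply/negP => pqH.
have dvHT : #|H| %| #|T|`!.
  by rewrite -card_Sym cardSg // subsetT.
have logH1 r : prime r -> #|T| < r.*2 -> r %| #|H| -> logn r #|H| = 1%N.
  move=> pr_r ltT2r rH; apply/eqP; rewrite eqn_leq.
  rewrite (leq_trans (dvdn_leq_log _ _ dvHT)) ?fact_gt0 ?logn_fact_leq1 //.
  by rewrite logn_gt0 mem_primes pr_r cardG_gt0.
have pH : p %| #|H| := dvdn_trans (dvdn_mulr _ (dvdnn p)) pqH.
have qH : q %| #|H| := dvdn_trans (dvdn_mull _ (dvdnn q)) pqH.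
have [K _ oK] : exists2 K : {group {perm T}}, K \subset H & #|K| = (p * q)%N.
  apply: solvable_pq_subgroup => //; [by rewrite neq_ltn ltpq | exact: logH1 |].
  by apply: logH1 => //; clear -ltpq ltT2p; lia.
have leqT : q <= #|T|.
  exact: prime_dvd_fact (dvdn_trans qH dvHT).
have qmodp : q %% p != 1%N.
  apply/eqP => mod1; have eq_q := divn_eq q p; rewrite mod1 in eq_q.
  have ltq2p := leq_ltn_trans leqT ltT2p.
  have q_p : q = p.+1.
    move: (q %/ p) eq_q => [|[|k]]; rewrite ?mulSn => eq_q; clear -ltpq ltq2p eq_q; lia.
  (* One of [p] and [p + 1] is even, hence equal to 2: [p = 2] gives [3 = q <= #|T| < 4], and
     [q = 2] gives [p = 1]. *)
  case: (even_prime pr_p) (even_prime pr_q) => [p2 _ | odd_p []].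
  - by case/eqP: neqT3; clear -p2 q_p leqT ltT2p; lia.
  - by have := prime_gt1 pr_p; clear -q_p; lia.
  - by rewrite q_p /= odd_p.
have [x _ ox] := exists_order_pq pr_p pr_q ltpq qmodp oK.
have /(order_primes_leq pr_p pr_q) : p != q by rewrite neq_ltn ltpq.
by move/(_ _ _ ox); clear -ltpq ltT2p; lia.
Qed.

(** * Even permutations of prescribed order *)

Lemma odd_permX (T : finType) (x : {perm T}) k : odd_perm (x ^+ k) = odd k && x.
Proof.
elim: k => [|k IHk]; first by rewrite odd_perm1.
by rewrite expgS odd_permM IHk /=; case: (odd k); case: (odd_perm x).
Qed.

Lemma odd_order_even (T : finType) (x : {perm T}) : odd #[x] -> ~~ odd_perm x.
Proof.
by move=> odd_x; rewrite -(andTb (odd_perm x)) -odd_x -odd_permX expg_order odd_perm1.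
Qed.

Lemma order_tpermM (T : finType) (a b c d : T) :
  uniq [:: a; b; c; d] -> #[tperm a b * tperm c d] = 2.
Proof.
rewrite /= !inE !negb_or -!andbA => /and5P[nab nac nad nbc /and3P[nbd ncd _]].
apply: nt_prime_order => //.
  rewrite expgMn; last first.
    apply/commgP/conjg_fixP; rewrite tpermJ !tpermD // eq_sym //.
  by rewrite !expgS !expg0 !mulg1 !tperm2 mulg1.
apply/eqP => /permP/(_ a); rewrite permM tpermL perm1 tpermD 1?eq_sym //.
by move/eqP: nab => nab /esym.
Qed.

(** The term [(p == 2).*2] asks for two extra points when [p = 2]: a transposition is odd, so two
    disjoint ones are multiplied. For odd [p], an element of order [p] is automatically even. *)
Lemma exists_even_perm_on (T : finType) (A : {set T}) p :
    prime p -> p + (p == 2).*2 <= #|A| ->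
  exists x, [/\ perm_on A x, ~~ odd_perm x & #[x] = p].
Proof.
move=> pr_p; have [-> /card_geqP[s [Us]] | odd_p leqA] := even_prime pr_p.
  case: s Us => [|a[|b[|c[|d[|]]]]] // Us _ sA; exists (tperm a b * tperm c d); split.
  - apply: perm_onM; apply: subset_trans (tperm_on _ _) _;
    by apply/subsetP => y; rewrite !inE => /orP[]/eqP->; apply: sA; rewrite !inE eqxx ?orbT.
  - move: Us; rewrite odd_permM !odd_tperm /= !inE !negb_or -!andbA.
    by case/and5P=> -> _ _ _ /and3P[_ -> _].
  - exact: order_tpermM.
have: p %| #|perm.Sym_group A|.
  rewrite cardsE card_perm dvdn_fact // prime_gt0 //=.
  exact: leq_trans (leq_addr _ _) leqA.
case/(Cauchy pr_p) => x; rewrite inE => Ax ox; exists x.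
by split=> //; apply: odd_order_even; rewrite ox.
Qed.

Lemma Alt_order_pq (T : finType) p q :
    prime p -> prime q -> p < q -> p + (p == 2).*2 + q <= #|T| ->
  exists2 x, x \in 'Alt_T & #[x] = (p * q)%N.
Proof.
move=> pr_p pr_q ltpq leT.
have [s [Us szs _]] := card_geqP (leq_trans (leq_addr _ _) leT).
have [x [Ax ev_x ox]] : exists x, [/\ perm_on [set z in s] x, ~~ odd_perm x & #[x] = p].
  by apply: exists_even_perm_on => //; rewrite cardsE (card_uniqP Us) szs.
have [y [Ay ev_y oy]] : exists y, [/\ perm_on (~: [set z in s]) y, ~~ odd_perm y & #[y] = q].
  apply: exists_even_perm_on => //; rewrite cardsCs setCK cardsE (card_uniqP Us) szs.
  (* Since [q > p >= 2], no extra points are needed for [q]. *)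
  by have := prime_gt1 pr_p; case: eqP; lia.
exists (x * y); first by rewrite Alt_even odd_permM (negPf ev_x).
rewrite orderM ?ox ?oy //; last by rewrite prime_coprime // dvdn_prime2 // neq_ltn ltpq.
by apply: perm_onC Ax Ay _; rewrite -setI_eq0 setICr.
Qed.

(** The involution [t] inverts the 3-cycle [c3], so they generate a dihedral group of order 6. The
    factor [tperm d e] only makes [t] even, whence the five points. *)
Lemma Alt_solvable_6 (T : finType) : 4 < #|T| ->
  exists H : {group {perm T}}, [&& H \subset 'Alt_T, solvable H & 6 %| #|H|].
Proof.
move=> /card_geqP[s [Us szs _]].
case: s Us szs => [|a[|b[|c[|d[|e[|]]]]]] // Us _.
move: (Us); rewrite /= !inE !negb_or -!andbA.
move=> /and5P[nab nac nad nae /and5P[nbc nbd nbe ncd /and3P[nce nde _]]].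
pose t := tperm a b * tperm d e; pose c3 := tperm a b * tperm b c.
have ot : #[t] = 2 by apply: order_tpermM; rewrite /= !inE !negb_or nab nad nae nbd nbe nde.
have oc : #[c3] = 3.
  apply: nt_prime_order => //.
    (* The braid relation of the two transpositions yields [c3 ^+ 3 = 1]. *)
    have braid : tperm a b * tperm b c * tperm a b = tperm b c * tperm a b * tperm b c.
      rewrite -{1}(tpermV a b) -{2}(tpermV b c) -!mulgA -!conjgE !tpermJ.
      by rewrite tpermL tpermR (tpermD nac nbc) tpermD // eq_sym.
    rewrite !expgS expg0 mulg1 /c3 !mulgA braid -(mulgA _ (tperm b c) (tperm b c)).
    by rewrite tperm2 mulg1 -(mulgA _ (tperm a b) (tperm a b)) tperm2 mulg1 tperm2.
  by apply/eqP => /permP/(_ a); rewrite permM tpermL perm1 tpermL => /esym/eqP; apply/negP.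
have Jc : c3 ^ t = c3^-1.
  rewrite conjgM (_ : c3 ^ tperm a b = c3^-1); last first.
    by rewrite /c3 conjgE tpermV !mulgA tperm2 mul1g invMg !tpermV.
  by rewrite conjVg /c3 conjMg !tpermJ !tpermD // eq_sym.
exists (<[c3]> <*> <[t]>)%G.
have nct : <[t]> \subset 'N(<[c3]>).
  by rewrite cycle_subG; apply/normP; rewrite -cycleJ Jc cycleV.
apply/and3P; split.
- rewrite join_subG !cycle_subG !Alt_even !odd_permM !odd_tperm.
  by rewrite nab nde nbc.
- have nc3 : <[c3]> <| <[c3]> <*> <[t]> by rewrite normalYl.
  rewrite (series_sol nc3) quotientYidl // quotient_sol.
    by rewrite abelian_sol ?cycle_abelian.
  by rewrite abelian_sol ?cycle_abelian.
rewrite (@Gauss_dvd 2 3) // -{1}ot -oc /order.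
by rewrite !cardSg ?joing_subl ?joing_subr.
Qed.

Theorem theoremA (n : nat) (G : {group {perm 'I_n}})
    (hG : G = ('Alt_('I_n))%G \/ G = ('Sym_('I_n))%G) :
  is_split (GK_graph G) /\ is_split (solv_graph G).
Proof.
have sAG : 'Alt_('I_n) \subset G by case: hG => ->; rewrite ?subxx ?subsetT.
have primeG (r : pi_vertex G) : prime (val r).
  by have := valP r; rewrite mem_primes => /and3P[].
have leG (r : pi_vertex G) : val r <= n.
  apply: prime_dvd_fact (primeG r) _.
  have := valP r; rewrite mem_primes => /and3P[_ _ /dvdn_trans]; apply.
  by have := cardSg (subsetT G); rewrite -[X in _ %| X -> _]/#|'Sym_('I_n)| card_Sym card_ord.
have GK_adj (r s : pi_vertex G) : val r < val s -> (val s).*2 <= n ->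
    (n != 6) || (val r != 2) -> GK_edge r s.
  move=> lt_rs les neq6; apply/andP; split.
    by apply: contraTneq lt_rs => ->; rewrite ltnn.
  have [|x Ax ox] := @Alt_order_pq 'I_n _ _ (primeG r) (primeG s) lt_rs.
    (* For odd [p], [p + q < 2q <= n]. For [p = 2], [4 + q <= 2q] once [q >= 5], while [q = 3] needs
       [n >= 7]: this is where [n = 6] fails. *)
    rewrite card_ord; move: (val r) (val s) (primeG r) (primeG s) lt_rs les neq6.
    move=> p q pr_p pr_q ltpq leq neq6; have := prime_gt1 pr_p.
    by case: (even_prime pr_q) => ?; case: (p =P 2) neq6 => ?; rewrite ?orbF ?orbT => ?; lia.
  by apply/exists_inP; exists x; rewrite ?(subsetP sAG) // ox.
have GK_nadj (r s : pi_vertex G) : r != s -> n < val r + val s -> ~~ GK_edge r s.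
  move=> nrs ltn; rewrite /GK_edge nrs; apply/exists_inP => -[x _ /eqP ox].
  by have := order_primes_leq (primeG r) (primeG s) nrs ox; rewrite card_ord leqNgt ltn.
have GK_solv (r s : pi_vertex G) : GK_edge r s -> solv_edge r s.
  case/andP=> nrs /exists_inP[x Gx /eqP ox]; rewrite /solv_edge nrs.
  apply/existsP; exists <[x]>%G; rewrite cycle_subG Gx abelian_sol ?cycle_abelian //=.
  by rewrite -ox /order.
have solv_adj (r s : pi_vertex G) : val r < val s -> (val s).*2 <= n -> solv_edge r s.
  move=> lt_rs les; case: (boolP ((n != 6) || (val r != 2))) => [neq6 | ].
    exact/GK_solv/GK_adj.
  rewrite negb_or !negbK => /andP[/eqP n6 /eqP r2]; apply/andP; split.
    by apply: contraTneq lt_rs => ->; rewrite ltnn.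
  have s3 : val s = 3 by lia.
  have [|H /and3P[sHA solH dvH]] := @Alt_solvable_6 'I_n; first by rewrite card_ord n6.
  by apply/existsP; exists H; rewrite (subset_trans sHA) // solH r2 s3.
have solv_nadj (r s : pi_vertex G) : val r < val s -> n < (val r).*2 -> n != 3 ->
    ~~ solv_edge r s.
  move=> lt_rs ltn n3; apply/nandP; right; apply/existsPn => H; apply/and3P => -[_ solH].
  by apply/negP; apply: solvable_pq_ndvd; rewrite ?card_ord.
split.
  pose P (r : pi_vertex G) := ((val r).*2 <= n) && ((n != 6) || (val r != 2)).
  apply: (@is_split_pred (GK_graph G) P) => /= r s nrs.
    case/andP=> ler r6 /andP[les s6]; have : val r != val s by [].
    by rewrite neq_ltn => /orP[] lt; [| rewrite GK_edge_sym]; apply: GK_adj.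
  (* If [n = 6] and one prime is 2, the other is odd and above 3, so the sum is at least 7;
     otherwise both exceed [n / 2]. *)
  move=> Pr Ps; apply: GK_nadj => //; rewrite /P in Pr Ps.
  have := primeG r; have := primeG s; have : val r != val s by [].
  move: (val r) (val s) Pr Ps => p q Pp Pq npq pr_q pr_p.
  have := prime_gt1 pr_p; have := prime_gt1 pr_q.
  by case: (even_prime pr_p) (even_prime pr_q) => [?|?] [?|?]; lia.
(* For [n = 3] no prime satisfies [2p <= n], yet 2 and 3 are adjacent for the solvable group
   [Sym_3]; with 2 in the clique, only 3 can remain outside. *)
pose P (r : pi_vertex G) := ((val r).*2 <= n) || (n == 3) && (val r == 2).
have clqP (r s : pi_vertex G) : P r -> P s -> val r < val s -> (val s).*2 <= n.
  have := prime_gt1 (primeG r); rewrite /P.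
  by move: (val r) (val s) => p q; lia.
have indP (r s : pi_vertex G) : ~~ P r -> ~~ P s -> val r < val s ->
    n < (val r).*2 /\ n != 3.
  have := leG s; have := prime_gt1 (primeG r); rewrite /P.
  by move: (val r) (val s) => p q; lia.
apply: (@is_split_pred (solv_graph G) P) => /= r s nrs Pr Ps;
  have : val r != val s by [].
  rewrite neq_ltn => /orP[] lt; [| rewrite solv_edge_sym]; apply: solv_adj => //.
    exact: (clqP r).
  exact: (clqP s).
rewrite neq_ltn => /orP[] lt; [| rewrite solv_edge_sym].
  by have [] := indP _ _ Pr Ps lt; apply: solv_nadj.
by have [] := indP _ _ Ps Pr lt; apply: solv_nadj.
Qed.
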